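(* Let $r\geq3$ be odd. Then for all $n\geq\frac{r+1}{2}$, $$\det\Big(-1;S_{\frac{r-1}{2}}^{(r)},S_{\frac{r+1}{2}}^{(r)},\ldots,S_{n+\frac{r-3}{2}}^{(r)}\Big)=\sum_{i=0}^{\lfloor (2n-r-1)/r\rfloor}\binom{2n-r-1-(r-1)i}{i}.$$
   Context: For odd $r\ge3$, define $S_0^{(r)}=\cdots=S_{r-2}^{(r)}=0$, $S_{r-1}^{(r)}=1$, and $S_n^{(r)}=S_{n-1}^{(r)}+S_{n-\frac{r+1}{2}}^{(r)}+S_{n-r}^{(r)}$ for $n\geq r$. For numbers $a_0,\ldots,a_n$, $\det(a_0;a_1,\ldots,a_n)$ denotes the determinant of the $n\times n$ Toeplitz--Hessenberg matrix whose $(i,j)$ entry is $a_{i-j+1}$ if $i-j+1\ge0$ and $0$ otherwise; here the $k$-th entry after the semicolon is $S_{k+\frac{r-3}{2}}^{(r)}$. *)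

(* Defs.v *)
From mathcomp Require Import all_boot all_order all_algebra.
Set Implicit Arguments.
Unset Strict Implicit.
Unset Printing Implicit Defensive.
Import GRing.Theory.
Local Open Scope ring_scope.

(* [Sprefix r n] is the list [:: S_0; ...; S_(n-1)]; it only serves to turn the
   course-of-values recursion into a structural one.  The defining equations of
   the sequence are [Snum_lt], [Snum_pred] and [Snum_rec] below. *)
Fixpoint Sprefix (r n : nat) : seq int :=
  if n is m.+1 then
    let s := Sprefix r m in
    rcons s (if (m < r.-1)%N then 0
             else if m == r.-1 then 1
             else s`_(m - 1) + s`_(m - (r + 1) %/ 2) + s`_(m - r))
  else [::].

Definition Snum (r n : nat) : int := (Sprefix r n.+1)`_n.

Lemma size_Sprefix r n : size (Sprefix r n) = n.
Proof. by elim: n => //= n IHn; rewrite size_rcons IHn. Qed.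

Lemma nth_Sprefix r n k : (k < n)%N -> (Sprefix r n)`_k = Snum r k.
Proof.
elim: n => // n IHn; rewrite ltnS leq_eqVlt => /predU1P[-> //|lt_kn].
by rewrite /= nth_rcons size_Sprefix lt_kn IHn.
Qed.

Lemma Snum_lt r n : (n < r.-1)%N -> Snum r n = 0.
Proof. by move=> lt_nr; rewrite /Snum /= nth_rcons size_Sprefix ltnn eqxx lt_nr. Qed.

Lemma Snum_pred r : Snum r r.-1 = 1.
Proof. by rewrite /Snum /= nth_rcons size_Sprefix ltnn !eqxx. Qed.

Lemma Snum_rec r n : (0 < r)%N -> (r <= n)%N ->
  Snum r n = Snum r (n - 1) + Snum r (n - (r + 1) %/ 2) + Snum r (n - r).
Proof.
move=> r_gt0 le_rn; have n_gt0 := leq_trans r_gt0 le_rn.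
have lt_rn : (r.-1 < n)%N by rewrite prednK.
have h_gt0 : (0 < (r + 1) %/ 2)%N by rewrite divn_gt0 // addn1.
rewrite {1}/Snum /= nth_rcons size_Sprefix ltnn eqxx ltnNge (ltnW lt_rn) /=.
by rewrite gtn_eqF // !nth_Sprefix // -[X in (_ < X)%N]subn0 ltn_sub2l.
Qed.

(* The matrix of det(a0; a_1, ..., a_n), where [a k] is the k-th entry after the
   semicolon (so [a 0] is never used).  The condition i - j + 1 >= 0 is written
   j <= i + 1; it is unaffected by indices starting at 0. *)
Definition toeplitz_hessenberg (R : nzRingType) (a0 : R) (a : nat -> R)
    (n : nat) : 'M[R]_n :=
  \matrix_(i < n, j < n)
    if (j <= i + 1)%N then
      (if (i + 1 - j)%N is 0%N then a0 else a (i + 1 - j)%N)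
    else 0.

(* Main.v *)
(** Write [r = 2m+1], and let [A], [E] be the generating functions of the entries
    and of the determinants.  The determinant of size [n] is a corner entry of
    the adjugate of the lower triangular Toeplitz matrix of the series [A - 1],
    hence [E = 1 / (1 - A)].  With [P = 1 - x - x^(m+1) - x^(2m+1)] one has
    [A = x^(m+1) / P], so [E = 1 + x^(m+1) / Q] with [Q = P - x^(m+1)].  The sum of
    binomials with top index [N] is the coefficient of [z^N] in
    [1 / (1 - z - z^r)], and
    [(1 - z - z^r) (1 + z + z^r) = Q(z^2)] shows that [1 / Q] is the series of its
    even-indexed coefficients. *)
Require Import Defs.
From mathcomp Require Import all_boot all_order all_algebra.
From mathcomp Require Import zify ring.
Set Implicit Arguments.
Unset Strict Implicit.
Unset Printing Implicit Defensive.
Import GRing.Theory.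
Local Open Scope ring_scope.

(** The series of [v] inverts that of [u] up to degree [n], so [w] is the first column of the
    inverse of [U]. *)
Lemma det_toeplitz_hessenberg (R : comNzRingType) (u v : nat -> R) (n : nat) :
  (forall i, (i <= n)%N -> \sum_(k < i.+1) u (i - k)%N * v k = (i == 0)%:R) ->
  \det (toeplitz_hessenberg (u 0%N) u n) = (-1) ^+ n * u 0%N ^+ n.+1 * v n.
Proof.
move=> uv1.
pose U : 'M[R]_n.+1 := \matrix_(i, j) if (j <= i)%N then u (i - j)%N else 0.
pose w : 'cV[R]_n.+1 := \col_i v i.
have Uw : U *m w = delta_mx 0 0.
  apply/colP=> i; rewrite !mxE andbT -[RHS]uv1 -1?ltnS ?ltn_ord //.
  rewrite (big_ord_widen n.+1 (fun k => u (i - k)%N * v k)) ?ltn_ord //.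
  rewrite [RHS]big_mkcond; apply: eq_bigr => k _; rewrite !mxE ltnS.
  by case: ifP; rewrite ?mul0r.
have detU : \det U = u 0%N ^+ n.+1.
  rewrite det_trig; last first.
    by apply/is_trig_mxP => i j lt_ij; rewrite mxE leqNgt lt_ij.
  under eq_bigr do rewrite mxE leqnn subnn.
  by rewrite prodr_const card_ord.
have adjU : (\adj U *m delta_mx 0 0 : 'cV_n.+1) ord_max 0 = u 0%N ^+ n.+1 * v n.
  by rewrite -Uw mulmxA mul_adj_mx mul_scalar_mx !mxE detU.
(* The cofactor deletes row 0 and the last column of [U]; the shift by one row turns [u (i - j)]
   into [u (i + 1 - j)]. *)
rewrite -mulrA -adjU -colE !mxE /cofactor /= add0n mulrA -exprMn mulrNN mulr1.
rewrite expr1n mul1r; congr (\det _); apply/matrixP=> i j; rewrite !mxE.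
rewrite lift0 lift_max addn1.
by case: ifP => // _; case: (_ - _)%N.
Qed.

(* Polynomials stand for power series modulo ['X^N]. *)
Definition coef_eq (R : nzRingType) (N : nat) (p q : {poly R}) :=
  forall i, (i < N)%N -> p`_i = q`_i.

Lemma coef_eqM (R : nzRingType) (N : nat) (p p' q : {poly R}) :
  coef_eq N p p' -> coef_eq N (p * q) (p' * q).
Proof.
move=> eq_p i lt_iN; rewrite !coefM; apply: eq_bigr => k _.
by rewrite eq_p // (leq_ltn_trans _ lt_iN) // -ltnS.
Qed.

Lemma coef_eqI (R : nzRingType) (N : nat) (p q q' : {poly R}) :
  p`_0 = 1 -> coef_eq N (p * q) (p * q') -> coef_eq N q q'.
Proof.
move=> p0 eq_pq; elim/ltn_ind => i IHi lt_iN.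
have := eq_pq i lt_iN; rewrite !coefM !big_ord_recl subn0 p0 !mul1r.
suff -> : \sum_(k < i) p`_(lift ord0 k) * q`_(i - lift ord0 k)
  = \sum_(k < i) p`_(lift ord0 k) * q'`_(i - lift ord0 k) by apply: addIr.
apply: eq_bigr => k _; rewrite IHi // lift0; first by have := ltn_ord k; lia.
by lia.
Qed.

Definition entry_den (m : nat) : {poly int} :=
  1 - 'X^1 - 'X^(m.+1) - 'X^((2 * m).+1).

Lemma entry_gf (m N : nat) : (0 < m)%N ->
  coef_eq N (entry_den m * \poly_(i < N) Snum (2 * m).+1 (i + m.-1)) 'X^(m.+1).
Proof.
move=> m_gt0 i lt_iN; rewrite /entry_den !mulrBl mul1r !coefB !coefXnM coefXn.
rewrite !coef_poly lt_iN !(leq_ltn_trans (leq_subr _ _) lt_iN).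
have S0 k : (k < 2 * m)%N -> Snum (2 * m).+1 k = 0.
    by move=> lt_k; rewrite Snum_lt.
have [lt_im | lt_mi | ->] := ltngtP i m.+1.
- have -> : (i < (2 * m).+1)%N by lia.
  rewrite (S0 (i + _)%N); last by lia.
  by case: ifP => [//|i_gt0]; rewrite S0 //; lia.
- have -> : (i < 1)%N = false by lia.
  rewrite (@Snum_rec (2 * m).+1 (i + _)) //; last by lia.
  have -> : (((2 * m).+1 + 1) %/ 2 = m.+1)%N by lia.
  have -> : (i + m.-1 - 1 = i - 1 + m.-1)%N by lia.
  have -> : (i + m.-1 - m.+1 = i - m.+1 + m.-1)%N by lia.
  (* Below degree [2m + 1] the last monomial contributes nothing, and the third term of the
     recurrence is one of the initial zeros. *)
  case: ifP => lt_i2m.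
    by rewrite (S0 (_ - (2 * m).+1)%N); [rewrite /=; ring | lia].
  have -> : (i + m.-1 - (2 * m).+1 = i - (2 * m).+1 + m.-1)%N by lia.
  by rewrite /=; ring.
- have -> : (m.+1 + m.-1 = (2 * m).+1.-1)%N by lia.
  rewrite Snum_pred (S0 (m.+1 - 1 + _)%N) ?(S0 (m.+1 - m.+1 + _)%N); try lia.
  by rewrite !ifT //; lia.
Qed.

Definition binsum (r N : nat) : nat :=
  \sum_(0 <= i < (N %/ r).+1) 'C(N - (r - 1) * i, i).

(* The extra terms vanish although the subtraction is truncated: their top index
   [N - (r - 1) * i] is then less than [i], and [i > 0]. *)
Lemma binsum_widen (r N K : nat) : (0 < r)%N -> (N %/ r < K)%N ->
  binsum r N = (\sum_(0 <= i < K) 'C(N - (r - 1) * i, i))%N.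
Proof.
move=> r_gt0 lt_NK; rewrite [RHS](big_cat_nat (n := (N %/ r).+1)) //=.
rewrite [X in (_ + X)%N]big_nat_cond [X in (_ + X)%N]big1 ?addn0 // => i.
rewrite andbT => /andP[lt_Ni _]; apply: bin_small.
have : (N < i * r)%N by rewrite -ltn_divLR.
by case: r r_gt0 {lt_NK lt_Ni} => // r _; rewrite mulnS; nia.
Qed.

(** Pascal's rule termwise, with [N - (r - 1)(i + 1) = (N + 1 - r) - (r - 1) i] to reindex the
    second part. *)
Lemma binsum_rec (r N : nat) : (0 < r)%N ->
  binsum r N.+1
  = (binsum r N + if (N.+1 < r)%N then 0 else binsum r (N.+1 - r))%N.
Proof.
move=> r_gt0.
have lt_div k K : (k <= N.+1)%N -> (N.+1 < K)%N -> (k %/ r < K)%N.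
  by move=> le_k lt_K; apply: leq_ltn_trans (leq_div _ _) _; lia.
rewrite (@binsum_widen r N.+1 N.+3) ?(@binsum_widen r N N.+3) ?lt_div //.
rewrite big_nat_recl // [in RHS]big_nat_recl // !bin0 -addnA; congr addn.
case: ltnP => [lt_Nr | le_rN].
  rewrite addn0; apply: eq_big_nat => i _.
  by rewrite !bin_small //; nia.
rewrite (@binsum_widen r (N.+1 - r) N.+2) ?lt_div ?leq_subr // -big_split /=.
apply: eq_big_nat => i _.
have [le_iN | lt_Ni] := leqP ((r - 1) * i.+1) N.
  rewrite subSn // binS; congr (_ + 'C(_, _))%N; nia.
(* Here the top indices are truncated to 0; [i > 0], since [i = 0] would contradict [r <= N + 1]. *)
by rewrite !bin_small //; nia.
Qed.

Lemma binsum0 (r : nat) : binsum r 0 = 1%N.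
Proof. by rewrite /binsum div0n big_nat1 bin0. Qed.

(** Writing [b] for [binsum], two uses of the recurrence reach [b(2i)], [b(2(i - m))] and the
    odd-indexed [b(2(i - m) + 1)]. A third use on the latter gives a second [b(2(i - m))], whence
    the coefficient 2 of [x^(m+1)] in [Q]. *)
Lemma binsum_gf (m N : nat) :
  coef_eq N ((entry_den m - 'X^(m.+1))
             * \poly_(i < N) (binsum (2 * m).+1 (2 * i))%:Z) 1.
Proof.
move=> i lt_iN; rewrite /entry_den !mulrBl mul1r !coefB !coefXnM coef1.
rewrite !coef_poly lt_iN !(leq_ltn_trans (leq_subr _ _) lt_iN).
case: i lt_iN => [|i] _; first by rewrite muln0 binsum0.
rewrite ltnS ltn0 subn1 mulnS add2n binsum_rec // binsum_rec // !ltnS /=.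
have [lt_im | le_mi] := ltnP i m.
  by rewrite !ifT; [ring | lia..].
rewrite [in X in Posz X]ifF; last by lia.
rewrite ifF; last by lia.
have -> : ((2 * i).+2 - (2 * m).+1 = (2 * (i - m)).+1)%N by lia.
have -> : ((2 * i).+1 - (2 * m).+1 = 2 * (i - m))%N by lia.
rewrite subSS binsum_rec //.
have [lt_i2m | le_2mi] := ltnP i (2 * m)%N.
  by rewrite !ifT; [ring | lia..].
rewrite ifF; last by lia.
have -> : ((2 * (i - m)).+1 - (2 * m).+1 = 2 * (i - 2 * m))%N by lia.
by rewrite subSS; ring.
Qed.

Theorem theorem11 (r n : nat) (hr3 : (3 <= r)%N) (hrodd : odd r)
    (hn : ((r + 1) %/ 2 <= n)%N) :
  \det (toeplitz_hessenberg (-1) (fun k : nat => Snum r (k + (r - 3) %/ 2)) n)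
  = (\sum_(0 <= i < ((2 * n - r - 1) %/ r).+1)
       'C(2 * n - r - 1 - (r - 1) * i, i))%N%:Z.
Proof.
pose m := r./2; have def_r : r = (2 * m).+1 by rewrite /m; lia.
have m_gt0 : (0 < m)%N by lia.
have -> : (2 * n - r - 1 = 2 * (n - m.+1))%N by lia.
have -> : ((r - 3) %/ 2 = m.-1)%N by lia.
rewrite -/(binsum r _) {}def_r in hn *; move: m m_gt0 hn => {hr3 hrodd r} m m_gt0 hn.
pose A := \poly_(i < n.+1) Snum (2 * m).+1 (i + m.-1).
pose G := \poly_(i < n.+1) (binsum (2 * m).+1 (2 * i))%:Z.
pose P := entry_den m; pose E := 1 + 'X^(m.+1) * G.
have P0 : P`_0 = 1 by rewrite /P /entry_den !coefB coef1 !coefXn.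
have A0 : A`_0 = 0 by rewrite coef_poly Snum_lt //=; lia.
have AE : coef_eq n.+1 ((A - 1) * - E) 1.
  apply: (coef_eqI P0) => i lt_in.
  have -> : P * ((A - 1) * - E) = P * A * - E + P * E by ring.
  rewrite coefD (coef_eqM _ (@entry_gf m n.+1 m_gt0)) // -coefD.
  have -> : 'X^(m.+1) * - E + P * E = P - 'X^(m.+1) + (P - 'X^(m.+1)) * G * 'X^(m.+1).
    by rewrite /E; ring.
  by rewrite coefD (coef_eqM _ (@binsum_gf m n.+1)) // -coefD mul1r subrK mulr1.
transitivity (\det (toeplitz_hessenberg (A - 1)`_0 (fun k => (A - 1)`_k) n)).
  congr (\det _); apply/matrixP=> i j; rewrite !mxE addn1.
  case: ifP => // _; case def_k: (i.+1 - j)%N => [|k].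
    by rewrite coefB A0 coef1.
  rewrite coefB coef1 subr0 coef_poly ifT //.
  by have := ltn_ord i; lia.
rewrite (@det_toeplitz_hessenberg _ (fun k => (A - 1)`_k) (fun k => (- E)`_k)).
  (* The signs [(-1)^n], [(-1)^(n+1)] and that of [- E] cancel, leaving the coefficient of degree
     [n] in [E], which is that of degree [n - (m + 1)] in [G]. *)
  rewrite coefB A0 coef1 sub0r exprS mulrCA -exprMn mulrNN mulr1 expr1n mulr1.
  rewrite coefN mulrNN mul1r coefD coef1 coefXnM coef_poly.
  have -> : (n == 0)%N = false by lia.
  by rewrite ifF ?ifT ?add0r //; lia.
by move=> i le_in; rewrite -coef1 -AE // coefMr.
Qed.
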